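(* Restricted to instances of the MST-edge-uncertainty problem in which every uncertainty area is open or trivial, algorithm u-red is $2$-update competitive.
   Context: MST-edge-uncertainty problem: a finite connected undirected graph $G=(V,E)$ is given; each edge $e$ has an unknown real weight $w_e$, and initially only a nonempty area $A_e\subseteq\mathbb{R}$ with $w_e\in A_e$ is known. An area is trivial if it is a single point; open means topologically open in $\mathbb{R}$. Updating an edge $e$ reveals $w_e$ and replaces $A_e$ by $\{w_e\}$. The algorithm must output the edge set of a minimum spanning tree of $G$ with the actual weights, and may only output it once the current areas guarantee it, i.e. once the edge set is a minimum spanning tree for every choice of weights in the current areas. $\mathit{OPT}$ is the minimum number of updates after which some edge set is guaranteed in this sense to be a minimum spanning tree. An algorithm is $k$-update competitive if there is a constant $c$ such that on every instance it makes at most $k\cdot\mathit{OPT}+c$ updates. Write $U_e=\sup A_e$, $L_e=\inf A_e$. For a cycle $C$, $e\in C$ is always maximal in $C$ if $L_e\ge U_c$ for all $c\in C\setminus\{e\}$. Order: $e<f$ if $L_e<L_f$ or ($L_e=L_f$ and $U_e<U_f$); $e\le f$ if $e<f$ or ($L_e=L_f$ and $U_e=U_f$), ties arbitrary. Algorithm u-red: index edges $e_1\le\dots\le e_m$; start with $\mathcal{G}$ the edgeless graph on $V$; for $i=1,\dots,m$: add $e_i$ to $\mathcal{G}$; if $\mathcal{G}$ has a cycle $C$, then if $C$ has an always maximal edge $e$, delete $e$ from $\mathcal{G}$, otherwise choose $f\in C$ with $U_f=\max_{c\in C}U_c$ and $g\in C\setminus\{f\}$ with $U_g>L_f$, update $f$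 and $g$, and restart the whole algorithm with the new areas; after the loop return $\mathcal{G}$. *)

(* Defs.v *)
From HB Require Import structures.
From mathcomp Require Import all_boot all_order all_algebra.
From mathcomp Require Import all_classical all_reals all_analysis.
Import Order.TTheory GRing.Theory Num.Theory.
Import numFieldNormedType.Exports.
Set Implicit Arguments.
Unset Strict Implicit.
Unset Printing Implicit Defensive.
Local Open Scope classical_set_scope.
Local Open Scope ring_scope.

(* The edge {x, y} is the two-element set [set x; y] of vertices. *)
Definition adj (V : finType) (F : {set {set V}}) : rel V :=
  fun x y => [set x; y]%SET \in F.

Definition connects (V : finType) (F : {set {set V}}) : Prop :=
  forall x y : V, connect (adj F) x y.

(* [C] is the edge set of a cycle of the graph [(V, F)]. *)
Definition is_cycle (V : finType) (F C : {set {set V}}) : Prop :=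
  exists p : seq V,
    [/\ (2 < size p)%N, ucycle (adj F) p &
        C = [set [set x; next p x]%SET | x in p]%SET].

Record graph := Graph {
  vertex :> finType;
  edges : {set {set vertex}};
  card_edge : forall e, e \in edges -> #|e| = 2%N;
  connected_graph : connects edges }.

Section Problem.
Variables (R : realType) (G : graph).

(* Values of weights and areas outside [edges G] are never used. *)
Definition weights := {set G} -> R.
Definition areas := {set G} -> set R.

Definition spanning_tree (T : {set {set G}}) : Prop :=
  [/\ T \subset edges G, connects T & forall C, ~ is_cycle T C].

Definition is_mst (w : weights) (T : {set {set G}}) : Prop :=
  spanning_tree T /\
  forall T', spanning_tree T' -> \sum_(e in T) w e <= \sum_(e in T') w e.

Definition realizes (A : areas) (w : weights) : Prop :=
  forall e, e \in edges G -> A e (w e).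

Definition guaranteed_mst (A : areas) (T : {set {set G}}) : Prop :=
  forall w : weights, realizes A w -> is_mst w T.

Definition update_area (A : areas) (e : {set G}) (x : R) : areas :=
  fun e' => if e' == e then [set x] else A e'.

Definition update_all (A : areas) (w : weights) (S : {set {set G}}) : areas :=
  fun e => if e \in S then [set w e] else A e.

Definition update_solution (A : areas) (w : weights) (S : {set {set G}}) :
    Prop :=
  S \subset edges G /\ exists T, guaranteed_mst (update_all A w S) T.

(* The default [edges G] of the minimum is itself an update solution as soon as
   [realizes A w] holds. *)
Definition OPT (A : areas) (w : weights) : nat :=
  #|[arg min_(S < edges G | `[< update_solution A w S >]) #|S|]%N|.

Definition U_ (A : areas) (e : {set G}) : \bar R := ereal_sup (EFin @` A e).
Definition L_ (A : areas) (e : {set G}) : \bar R := ereal_inf (EFin @` A e).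

Definition trivial_area (X : set R) : Prop := exists x, X = [set x].

Definition open_or_trivial (A : areas) : Prop :=
  forall e, e \in edges G -> open (A e) \/ trivial_area (A e).

Definition always_maximal (A : areas) (C : {set {set G}}) (e : {set G}) : Prop :=
  e \in C /\ forall c, c \in (C :\ e)%SET -> (U_ A c <= L_ A e)%E.

Definition edge_lt (A : areas) : rel {set G} := fun e f =>
  ((L_ A e < L_ A f)%E || ((L_ A e == L_ A f) && (U_ A e < U_ A f)%E)).

Definition edge_le (A : areas) : rel {set G} := fun e f =>
  edge_lt A e f || ((L_ A e == L_ A f) && (U_ A e == U_ A f)).

End Problem.

(* One move of an online algorithm whose states range over [S]: a computation
   step, the update of an edge (the continuation receives the revealed weight,
   the only way in which the algorithm has access to the weights), or the
   output of an edge set. *)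
Variant action (R : realType) (G : graph) (S : Type) :=
  | Compute of S
  | Update of {set G} & (R -> S)
  | Output of {set {set G}}.
Arguments Compute {R G S}.
Arguments Update {R G S}.
Arguments Output {R G S}.

(* [move] is a relation, so as to allow for unspecified choices. *)
Record algorithm (R : realType) := Algorithm {
  state : graph -> Type;
  start : forall G, areas R G -> state G;
  move : forall G, state G -> action R G (state G) -> Prop }.

Section Competitiveness.
Variables (R : realType) (alg : algorithm R).

Section Runs.
Variables (G : graph) (A : areas R G) (w : weights R G).

(* [reaches s h]: some run on the instance [(G, A, w)] leads to the state [s]
   after the updates listed in [h] (repetitions count). *)
Inductive reaches : state alg G -> seq {set G} -> Prop :=
  | reaches_start : reaches (start alg A) [::]
  | reaches_compute s s' h :
      reaches s h -> move s (Compute s') -> reaches s' h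
  | reaches_update s e k h :
      reaches s h -> move s (Update e k) -> reaches (k (w e)) (e :: h).

Definition next_state (s' s : state alg G) : Prop :=
  move s (Compute s') \/ exists e k, move s (Update e k) /\ s' = k (w e).

Definition terminates : Prop := Acc next_state (start alg A).

(* Every run ends with an output, which is guaranteed by the then current
   areas to be a minimum spanning tree. *)
Definition correct : Prop :=
  [/\ terminates,
      forall s h, reaches s h -> exists a, move s a,
      forall s h e k,
        reaches s h -> move s (Update e k) -> e \in edges G &
      forall s h T, reaches s h -> move s (Output T) ->
        guaranteed_mst (update_all A w [set e in h]%SET) T].

End Runs.

Definition update_competitive (P : forall G, areas R G -> Prop) (k : R) : Prop :=
  exists c : R, forall (G : graph) (A : areas R G) (w : weights R G),
    realizes A w -> P G A ->
    correct A w /\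
    forall s h, reaches A w s h -> (size h)%:R <= k * (OPT A w)%:R + c.

End Competitiveness.

(* [URedStart A]: (re)start with the current areas [A];
   [URedLoop A s F]: the edges [s] remain to be considered, and [F] is the edge
   set of the graph built so far;
   [URedSecond A g]: [f] has just been updated, and [g] is about to be. *)
Variant ured_state (R : realType) (G : graph) :=
  | URedStart of areas R G
  | URedLoop of areas R G & seq {set G} & {set {set G}}
  | URedSecond of areas R G & {set G}.

Inductive ured_move (R : realType) (G : graph) :
    ured_state R G -> action R G (ured_state R G) -> Prop :=
  | ured_sort A s :
      perm_eq s (enum (edges G)) -> sorted (edge_le A) s ->
      ured_move (URedStart A) (Compute (URedLoop A s finset.set0))
  | ured_add A e s F :
      (forall C, ~ is_cycle (e |: F)%SET C) ->
      ured_move (URedLoop A (e :: s) F)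
                (Compute (URedLoop A s (e |: F)%SET))
  | ured_delete A e s F C d :
      is_cycle (e |: F)%SET C -> always_maximal A C d ->
      ured_move (URedLoop A (e :: s) F)
                (Compute (URedLoop A s ((e |: F) :\ d)%SET))
  | ured_update A e s F C f g :
      is_cycle (e |: F)%SET C -> (forall d, ~ always_maximal A C d) ->
      f \in C -> U_ A f = \big[maxe/-oo%E]_(c in C) U_ A c ->
      g \in (C :\ f)%SET -> (L_ A f < U_ A g)%E ->
      ured_move (URedLoop A (e :: s) F)
                (Update f (fun x => URedSecond (update_area A f x) g))
  | ured_update2 A g :
      ured_move (URedSecond A g)
                (Update g (fun x => URedStart (update_area A g x)))
  | ured_return A F :
      ured_move (URedLoop A [::] F) (Output F).

Definition u_red (R : realType) : algorithm R :=
  @Algorithm R (ured_state R) (@URedStart R) (@ured_move R).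

(* Main.v *)
Require Import Defs.
From mathcomp Require Import all_boot all_order all_algebra.
From mathcomp Require Import all_classical all_reals all_analysis.
Import Order.TTheory GRing.Theory Num.Theory.
Import numFieldNormedType.Exports.
Set Implicit Arguments.
Unset Strict Implicit.
Unset Printing Implicit Defensive.
Local Open Scope ring_scope.

(* Whenever the algorithm updates a pair {f, g}, every update solution [S] of
   the current areas meets {f, g}, so each pair lowers the optimum of the
   remaining instance by at least one.  Otherwise a tree [T] would be a minimum
   spanning tree for all values of f and g, the other edges having their actual
   weights or areas.  With w_f close to U_f, f is the only heaviest edge of the
   cycle, so it is not in [T].  With w_f close to L_f and L_f < w_g, since f is
   not in [T], the ends of f are joined in [T] by edges of weight at most w_f,
   hence at most L_f.  By the ordering these edges have all been processed, and
   deletions of always maximal edges preserve bottleneck connectivity, so the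
   ends of f are also joined in the current forest by edges of weight at most
   L_f, i.e. avoiding f and g.  But deleting g from the forest plus the new
   edge leaves a forest containing f, a contradiction. *)

(** * Connectivity, bridges and cycles in finite graphs given by edge sets *)

Section Forests.
Variable V : finType.
Implicit Types (F H C : {set {set V}}) (x y a b : V).

Lemma set2_inj x y a b : [set x; y]%SET = [set a; b]%SET ->
  (x = a /\ y = b) \/ (x = b /\ y = a).
Proof.
move=> xz.
have := set21 x y; have := set22 x y; rewrite xz !in_set2.
have := set21 a b; have := set22 a b; rewrite -xz !in_set2.
by do 4 case/orP => /eqP ?; subst; auto.
Qed.

Lemma adj_sym F : symmetric (adj F).
Proof. by move=> x y; rewrite /adj finset.setUC. Qed.

Lemma connect_adj_sym F x y : connect (adj F) x y = connect (adj F) y x.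
Proof. exact: (sym_connect_sym (@adj_sym F)). Qed.

Lemma connect_adj_sub F H :
  (forall x y, [set x; y]%SET \in F -> connect (adj H) x y) ->
  forall x y, connect (adj F) x y -> connect (adj H) x y.
Proof. by move=> FH x y; apply: connect_sub => {}x {}y; apply: FH. Qed.

Lemma connect_adj_subset F H x y :
  F \subset H -> connect (adj F) x y -> connect (adj H) x y.
Proof.
move=> FH; apply: connect_adj_sub => a b abF.
exact/connect1/(fintype.subsetP FH).
Qed.

Lemma connect_adjU1 H a b x y :
  connect (adj ([set a; b] |: H)%SET) x y ->
  [\/ connect (adj H) x y, connect (adj H) x a /\ connect (adj H) b y
    | connect (adj H) x b /\ connect (adj H) a y].
Proof.
case/connectP => p; elim: p x => [|z p IHp] x /=.
  by move=> _ ->; apply: Or31.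
rewrite {1}/adj in_setU1 => /andP[/orP[/eqP xz|xz] /IHp IH] /IH {IHp IH}.
  have [[-> ->]|[-> ->]] := set2_inj xz.
  - by case=> [h|[_ h]|[_ h]]; [apply: Or32|apply: Or32|apply: Or31].
  - by case=> [h|[_ h]|[_ h]]; [apply: Or33|apply: Or31|apply: Or33].
have {}xz : connect (adj H) x z by apply: connect1.
by case=> [h|[h k]|[h k]]; [apply: Or31|apply: Or32|apply: Or33];
  rewrite ?(connect_trans xz).
Qed.

(** As [x] and [y] are not joined in [H], their path crosses the added edge, so one of them reaches
    [a] and the other [b] within [H]. This is the basis of the edge exchanges below. *)
Lemma connect_adj_exchange H a b x y :
  connect (adj ([set a; b] |: H)%SET) x y -> ~~ connect (adj H) x y ->
  connect (adj ([set x; y] |: H)%SET) a b.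
Proof.
move=> abxy /negP nxy.
have sub u v : connect (adj H) u v -> connect (adj ([set x; y] |: H)%SET) u v.
  exact/connect_adj_subset/finset.subsetUr.
have xy : connect (adj ([set x; y] |: H)%SET) x y.
  exact/connect1/setU11.
case: (connect_adjU1 abxy) => [//|[xa by_]|[xb ay]].
  rewrite connect_adj_sym in xa; rewrite connect_adj_sym in by_.
  exact: connect_trans (sub _ _ xa) (connect_trans xy (sub _ _ by_)).
apply: (connect_trans (sub _ _ ay)); rewrite connect_adj_sym.
by rewrite connect_adj_sym in xb; apply: connect_trans (sub _ _ xb) xy.
Qed.

(** Acyclicity in the form that every edge is a bridge. This speaks of connectivity only, which
    suits edge exchanges; [forest_acyclic] and [acyclic_forest] relate it to cycles. *)
Definition forest F : Prop :=
  forall x y, [set x; y]%SET \in F ->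
    ~~ connect (adj (F :\ [set x; y])%SET) x y.

Lemma forestS F H : F \subset H -> forest H -> forest F.
Proof.
move=> FH fH x y xyF; apply: contra (fH x y (fintype.subsetP FH _ xyF)).
exact/connect_adj_subset/finset.setSD.
Qed.

Lemma forestU1 F x y :
  forest F -> ~~ connect (adj F) x y -> forest ([set x; y] |: F)%SET.
Proof.
move=> fF nxy.
have xyF : [set x; y]%SET \notin F.
  by apply: contra nxy => xyF; apply: connect1.
move=> a b; case: (eqVneq [set a; b]%SET [set x; y]%SET) => [eab _|neq].
  apply: contra nxy; rewrite eab finset.setU1K // => ab.
  by case: (set2_inj eab) => -[<- <-]; rewrite // connect_adj_sym.
(* An old edge stays a bridge: otherwise exchanging it with the new one would join [x] to [y] inside
   [F]. *)
rewrite in_setU1 (negPf neq) /= => abF; apply: contra nxy => ab.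
rewrite -(finset.setD1K abF).
apply: connect_adj_exchange (fF _ _ abF).
apply: connect_adj_subset ab; apply/fintype.subsetP => d.
by rewrite !inE; case: (d == [set x; y]%SET); rewrite ?andbF ?andbT.
Qed.

Lemma is_cycle_subset F C : is_cycle F C -> C \subset F.
Proof.
case=> p [_ /andP[cp _] ->]; apply/fintype.subsetP => _ /imsetP[z zp ->].
exact: next_cycle cp zp.
Qed.

(** After rotating the cycle to begin at one end of the edge, the remaining vertices form a path
    from the other end back to it. *)
Lemma is_cycle_connect F C x y :
  is_cycle F C -> [set x; y]%SET \in C ->
  connect (adj (C :\ [set x; y])%SET) x y.
Proof.
case=> p [p2 /andP[_ up] ->]; set C' := [set _ | z in p]%SET.
case/imsetP => z zp exy.
wlog [-> ->] : x y exy / x = next p z /\ y = z.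
  move=> Hw; case: (set2_inj exy) => -[ex ey]; last exact: Hw.
  by rewrite connect_adj_sym finset.setUC; apply: Hw; rewrite 1?finset.setUC.
case: (rot_to zp) => i q eq_p.
(* Cycles on one or two vertices are excluded by [2 < size p]. *)
case: q eq_p => [|u [|v r]] eq_p;
  [by move: p2; rewrite -(size_rot i) eq_p..|].
have uq := up; rewrite -(rot_uniq i) eq_p in uq.
have nz : next p z = u by rewrite -(next_rot i up) eq_p /= eqxx.
pose s := v :: r; rewrite -/s in eq_p uq.
have : path (frel (next p)) u (rcons s z).
  have fn : frel (next (z :: u :: s)) =2 frel (next p).
    by move=> a b /=; rewrite -(next_rot i up) eq_p.
  have : path (frel (next (z :: u :: s))) z (u :: rcons s z).
    exact: cycle_next uq.
  by rewrite (eq_path fn) => /andP[].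
rewrite rcons_path => /andP[pus /eqP lst].
have memp a : a \in u :: s -> a \in p.
  by move=> h; rewrite -(mem_rot i) eq_p inE h orbT.
move: uq; rewrite /= -/s => /andP[zus /andP[us _]].
rewrite nz; apply: (@connect_trans _ _ (last u s)); last first.
  apply: connect1; rewrite /adj in_setD1; apply/andP; split; last first.
    by rewrite -[X in [set _; X]%SET]lst; apply: imset_f; exact/memp/mem_last.
  (* The closing edge from [last u s] to [z] is not the removed one, since [s] is nonempty and
     avoids [u]. *)
  apply: contraNneq us => /set2_inj[[<- _]|[_ zu]];
    first exact: (mem_last v r).
  by move: zus; rewrite zu inE eqxx.
apply/connectP; exists s => //.
apply: (@sub_in_path _ (mem (u :: s)) (frel (next p))); last 2 first.
- exact/allP.
- exact: pus.
move=> a b ha hb /= /eqP ab; rewrite /adj in_setD1 -ab; apply/andP; split.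
  rewrite ab; apply: contraNneq zus => eab.
  by have := set22 u z; rewrite -eab in_set2 => /orP[]/eqP->.
by apply: imset_f; apply: memp.
Qed.

Lemma connect_is_cycle F x y :
  x != y -> [set x; y]%SET \notin F -> connect (adj F) x y ->
  exists2 C, is_cycle ([set x; y] |: F)%SET C & [set x; y]%SET \in C.
Proof.
move=> nxy xyF /connectP[p0 p0P ey]; subst y.
case/shortenP: p0P nxy xyF => p; case/lastP: p => [|q y]; rewrite ?eqxx //=.
rewrite last_rcons => pq uq _ nxy xyF.
(* A path of a single step would be the edge itself, which is not in [F]; hence the cycle has at
   least three vertices. *)
have [q0|q0] := posnP (size q).
  by move/size0nil: q0 pq xyF => -> /=; rewrite /adj andbT => ->.
pose c := y :: x :: q.
have xC : [set x; y]%SET = [set y; next c y]%SET.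
  by rewrite /c /= eqxx finset.setUC.
exists [set [set z; next c z] | z in c]%SET; last first.
  by rewrite xC; apply: imset_f; rewrite /c inE eqxx.
exists c; split => //; apply/andP; split.
  rewrite /c /=; apply/andP; split.
    by rewrite /adj finset.setUC setU11.
  by apply: sub_path pq => a b; rewrite /adj in_setU1 orbC => ->.
have -> : uniq c = uniq (rcons (x :: q) y) by rewrite rcons_uniq.
by [].
Qed.

(** A path from [x] to [y] avoiding [d] could replace the new edge on the rest of the cycle and join
    the ends of [d], although [d] is a bridge of [F]. *)
Lemma is_cycle_not_connect F C x y d :
  forest F -> is_cycle ([set x; y] |: F)%SET C -> d \in C ->
  d != [set x; y]%SET -> (forall e, e \in F -> exists a b, e = [set a; b]%SET) ->
  ~~ connect (adj (F :\ d)%SET) x y.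
Proof.
move=> fF cC dC dxy edgesF.
have dF : d \in F.
  by have := fintype.subsetP (is_cycle_subset cC) _ dC; rewrite in_setU1 (negPf dxy).
have [a [b dab]] := edgesF _ dF; subst d.
apply: contra (fF _ _ dF) => xy.
apply: connect_adj_sub (is_cycle_connect cC dC) => u v.
rewrite in_setD1 => /andP[uv].
move/(fintype.subsetP (is_cycle_subset cC)); rewrite in_setU1 => /orP[/eqP|uvF].
  by case/set2_inj => -[-> ->] //; rewrite connect_adj_sym.
by apply: connect1; rewrite /adj in_setD1 uv.
Qed.

Lemma forest_break F C x y d :
  forest F -> is_cycle ([set x; y] |: F)%SET C -> d \in C ->
  (forall e, e \in F -> exists a b, e = [set a; b]%SET) ->
  forest (([set x; y] |: F) :\ d)%SET.
Proof.
move=> fF cC dC eF; have [->|dxy] := eqVneq d [set x; y]%SET.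
  apply: forestS fF; apply/fintype.subsetP => c; rewrite !inE.
  by case: (c == [set x; y]%SET).
have nxy := is_cycle_not_connect fF cC dC dxy eF.
have fFd : forest (F :\ d)%SET by apply: forestS fF; apply: finset.subsetDl.
apply: forestS (forestU1 fFd nxy); apply/fintype.subsetP => c; rewrite !inE.
by case: (c == [set x; y]%SET) => //=.
Qed.

(** The ends must be distinct because a singleton is never a bridge, yet lies on no cycle. *)
Lemma forest_acyclic F :
  (forall x y, [set x; y]%SET \in F -> x != y) ->
  (forall C, ~ is_cycle F C) -> forest F.
Proof.
move=> nF acF x y xyF; apply/negP => xy.
have [|C cC _] := connect_is_cycle (nF _ _ xyF) _ xy.
  by rewrite in_setD1 eqxx.
by apply: (acF C); rewrite finset.setD1K in cC.
Qed.

Lemma acyclic_forest F C : forest F -> ~ is_cycle F C.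
Proof.
move=> fF cC.
have [x [y xyC]] : exists x y, [set x; y]%SET \in C.
  case: cC => -[|x p] [] // _ _ ->; exists x, (next (x :: p) x).
  by apply: imset_f; rewrite inE eqxx.
have xyF := fintype.subsetP (is_cycle_subset cC) _ xyC.
have /negP[] := fF _ _ xyF.
exact: connect_adj_subset (finset.setSD _ (is_cycle_subset cC))
  (is_cycle_connect cC xyC).
Qed.

End Forests.

(** * Exchange properties and a bottleneck criterion for minimum spanning trees *)

Section SpanningTrees.
Variables (R : realType) (G : graph).
Implicit Types (T F C : {set {set G}}) (x y a b : G) (w : weights R G).

Lemma edgeP e : e \in edges G -> exists x y, e = [set x; y]%SET.
Proof. by move=> /card_edge/eqP/cards2P[x [y] [_ ->]]; exists x, y. Qed.

Lemma edge_neq x y : [set x; y]%SET \in edges G -> x != y.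
Proof. by move=> /card_edge; rewrite cards2; case: (x != y). Qed.

Lemma spanning_treeP T :
  spanning_tree T <-> [/\ T \subset edges G, connects T & forest T].
Proof.
split=> -[TE Tc Ta]; split=> //; last by move=> C; apply: acyclic_forest.
apply: forest_acyclic => // x y /(fintype.subsetP TE); exact: edge_neq.
Qed.

Lemma spanning_tree_swap T a b x y :
  spanning_tree T -> [set a; b]%SET \in T -> [set x; y]%SET \in edges G ->
  ~~ connect (adj (T :\ [set a; b])%SET) x y ->
  spanning_tree ([set x; y] |: (T :\ [set a; b]))%SET.
Proof.
move=> /spanning_treeP[TE Tc Tf] abT xyE nxy; apply/spanning_treeP; split.
- rewrite finset.subUset finset.sub1set xyE /=.
  exact: fintype.subset_trans (finset.subsetDl _ _) TE.
- move=> u v; apply: connect_adj_sub (Tc u v) => {}u {}v uvT.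
  have [uv|uv] := eqVneq [set u; v]%SET [set a; b]%SET; last first.
    by apply: connect1; rewrite /adj !inE uv uvT orbT.
  suff ab : connect (adj ([set x; y] |: (T :\ [set a; b]))%SET) a b.
    by case: (set2_inj uv) => -[-> ->]; rewrite // connect_adj_sym.
  by apply: connect_adj_exchange nxy; rewrite finset.setD1K.
- by apply: forestU1 nxy; apply: forestS Tf; exact: finset.subsetDl.
Qed.

(** A connecting edge set of least cardinality is a forest, as an edge that is not a bridge could be
    dropped. *)
Lemma spanning_tree_exists : exists T, spanning_tree T.
Proof.
pose P T := (T \subset edges G) && `[< connects T >].
have P0 : P (edges G) by rewrite /P fintype.subxx; apply/asboolP/connected_graph.
case: (fintype.arg_minnP (fun T => #|T|) P0) => T /andP[TE /asboolP Tc] minT.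
exists T; apply/spanning_treeP; split=> // x y xyT; apply/negP => xy.
suff /minT : P (T :\ [set x; y])%SET.
  by rewrite (cardsD1 [set x; y]%SET T) xyT ltnn.
apply/andP; split; first exact: fintype.subset_trans (finset.subsetDl _ _) TE.
apply/asboolP => u v.
apply: connect_adj_sub (Tc u v) => a b abT.
have [ab|ab] := eqVneq [set a; b]%SET [set x; y]%SET.
  by case: (set2_inj ab) => -[-> ->]; rewrite // connect_adj_sym.
by apply: connect1; rewrite /adj in_setD1 ab.
Qed.

Lemma mst_exists w : exists T, is_mst w T.
Proof.
have [T0 sT0] := spanning_tree_exists.
have P0 : `[< spanning_tree T0 >] by apply/asboolP.
case: (@arg_minP _ _ _ T0 (fun T => `[< spanning_tree T >])
  (fun T => \sum_(e in T) w e) P0) => T /asboolP sT minT.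
by exists T; split=> // T' sT'; apply: minT; apply/asboolP.
Qed.

Lemma eq_is_mst w w' T : {in edges G, w =1 w'} -> is_mst w T -> is_mst w' T.
Proof.
move=> ww' [sT minT]; split=> // T' sT'.
have eqw (S : {set {set G}}) : S \subset edges G ->
    \sum_(e in S) w' e = \sum_(e in S) w e.
  by move=> SE; apply: eq_bigr => e /(fintype.subsetP SE)/ww'.
by rewrite !eqw ?minT //; [case: sT'|case: sT].
Qed.

Lemma sum_swap w T c d : c \in T -> d \notin (T :\ c)%SET ->
  \sum_(e in d |: (T :\ c)%SET) w e = \sum_(e in T) w e - w c + w d.
Proof.
move=> cT dT; rewrite big_setU1 // (big_setD1 c cT) /=.
by rewrite [w c + _]addrC addrK addrC.
Qed.

Lemma mst_swap_le w T a b x y :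
  is_mst w T -> [set a; b]%SET \in T -> [set x; y]%SET \in edges G ->
  ~~ connect (adj (T :\ [set a; b])%SET) x y ->
  w [set a; b]%SET <= w [set x; y]%SET.
Proof.
move=> [sT minT] abT xyE nxy.
have := minT _ (spanning_tree_swap sT abT xyE nxy); rewrite sum_swap //.
  by rewrite -addrA lerDl addrC subr_ge0.
by apply: contra nxy => xyT; apply: connect1.
Qed.

Lemma connect_not_in F x y H :
  connect (adj F) x y -> ~~ connect (adj H) x y ->
  exists a b, [set a; b]%SET \in F /\ ~~ connect (adj H) a b.
Proof.
move=> xy /negP nxy; apply: contrapT => nex; apply: nxy.
apply: connect_adj_sub xy => a b abF; apply/negPn/negP => nab.
by apply: nex; exists a, b.
Qed.

(** If [f] were in [T], another edge of the cycle would cross the cut that removing [f] opens in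
    [T], and swapping the two would give a lighter tree. *)
Lemma mst_cycle_max w T F C f :
  is_mst w T -> is_cycle F C -> F \subset edges G -> f \in C ->
  (forall c, c \in (C :\ f)%SET -> w c < w f) -> f \notin T.
Proof.
move=> mT cC FE fC maxf; apply/negP => fT.
have CE c : c \in C -> c \in edges G.
  by move/(fintype.subsetP (is_cycle_subset cC))/(fintype.subsetP FE).
have [x [y ef]] := edgeP (CE _ fC); subst f.
have /spanning_treeP[_ _ Tf] := mT.1.
have [a [b [abCf nab]]] := connect_not_in (is_cycle_connect cC fC) (Tf _ _ fT).
have abC : [set a; b]%SET \in C by move: abCf; rewrite inE => /andP[].
by have := mst_swap_le mT fT (CE _ abC) nab; rewrite leNgt maxf.
Qed.

(** Each edge of the tree path between [x] and [y] can be swapped for the edge outside [T], so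
    minimality makes it no heavier. *)
Lemma mst_connect_le w T x y :
  is_mst w T -> [set x; y]%SET \in edges G -> [set x; y]%SET \notin T ->
  connect (adj [set c in T | w c <= w [set x; y]%SET]%SET) x y.
Proof.
move=> mT xyE xyT; have /spanning_treeP[TE Tc Tf] := mT.1.
have [C cC xyC] := connect_is_cycle (edge_neq xyE) xyT (Tc x y).
apply: connect_adj_subset (is_cycle_connect cC xyC).
apply/fintype.subsetP => c; rewrite !inE => /andP[cxy cC'].
have cT : c \in T.
  by have := fintype.subsetP (is_cycle_subset cC) _ cC'; rewrite in_setU1 (negPf cxy).
rewrite cT /=.
have ET e : e \in T -> exists a b, e = [set a; b]%SET.
  by move/(fintype.subsetP TE)/edgeP.
have nxy := is_cycle_not_connect Tf cC cC' cxy ET.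
by have [a [b ec]] := ET _ cT; subst c; apply: mst_swap_le nxy.
Qed.

(** Any rival tree is turned into [F] by swaps that never raise the weight; the induction is on the
    number of its edges outside [F]. *)
Lemma bottleneck_mst w F :
  spanning_tree F ->
  (forall x y, [set x; y]%SET \in edges G ->
     connect (adj [set d in F | w d <= w [set x; y]%SET]%SET) x y) ->
  is_mst w F.
Proof.
move=> sF bF; split=> // T; have /spanning_treeP[FE Fc Ff] := sF.
have [n] := ubnP #|T :\: F|%SET; elim: n T => // n IHn T ltn sT.
have /spanning_treeP[TE Tc Tf] := sT.
have [/eqP TF0|[e]] := set_0Vmem (T :\: F)%SET.
  have TF : T \subset F by rewrite -finset.setD_eq0.
  suff -> : F = T by [].
  apply/eqP; rewrite finset.eqEsubset TF andbT; apply/fintype.subsetP => c cF.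
  have [x [y ec]] := edgeP (fintype.subsetP FE _ cF); subst c.
  apply: contraT => cT; have /negP[] := Ff _ _ cF.
  apply: connect_adj_subset (Tc x y); apply/fintype.subsetP => d dT.
  rewrite !inE (fintype.subsetP TF _ dT) andbT.
  by apply: contraNneq cT => <-.
rewrite inE => /andP[eF eT].
have [x [y ee]] := edgeP (fintype.subsetP TE _ eT); subst e.
(* [F] joins the ends of [e] by edges no heavier than [e], and one of these crosses the cut left by
   removing [e] from [T]. *)
have [a [b [abF nab]]] :=
  connect_not_in (bF x y (fintype.subsetP TE _ eT)) (Tf _ _ eT).
move: abF; rewrite inE => /andP[abF leab].
have sT' := spanning_tree_swap sT eT (fintype.subsetP FE _ abF) nab.
apply: le_trans (IHn _ _ sT') _; last first.
  rewrite sum_swap //; first by rewrite -addrA gerDl addrC subr_le0.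
  by apply: contra nab => abT; apply: connect1.
rewrite -ltnS; apply: leq_trans ltn; rewrite ltnS.
apply: proper_card; apply/properP; split.
  apply/fintype.subsetP => c; rewrite !inE => /andP[cF /orP[/eqP ec|/andP[_ ->]]].
    by rewrite ec abF in cF.
  by rewrite cF.
exists [set x; y]%SET; rewrite !inE eF ?eT //= eqxx /= orbF.
by apply: contraNneq eF => ->.
Qed.

End SpanningTrees.

(** * Uncertainty areas, the processing order, the loop invariant and the updated pairs *)

Section Areas.
Variables (R : realType) (G : graph).
Implicit Types (A B : areas R G) (w : weights R G) (e c f : {set G}).
Implicit Types (S T F C : {set {set G}}).

Lemma open_lt_sup (X : set R) (x : R) :
  open X -> X x -> (x%:E < ereal_sup (EFin @` X))%E.
Proof.
move=> oX Xx; have /nbhs_ballP[r /= r0 rX] : nbhs x X by exact: open_nbhs_nbhs.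
apply: (@lt_le_trans _ _ (x + r / 2)%:E).
  by rewrite lte_fin ltrDl divr_gt0.
apply: ereal_sup_ubound; exists (x + r / 2) => //; apply: rX.
rewrite /ball /= opprD addrA subrr add0r normrN gtr0_norm ?divr_gt0 //.
by rewrite ltr_pdivrMr // ltr_pMr // ltr1n.
Qed.

Lemma open_gt_inf (X : set R) (x : R) :
  open X -> X x -> (ereal_inf (EFin @` X) < x%:E)%E.
Proof.
move=> oX Xx; have /nbhs_ballP[r /= r0 rX] : nbhs x X by exact: open_nbhs_nbhs.
apply: (@le_lt_trans _ _ (x - r / 2)%:E); last first.
  by rewrite lte_fin gtrDl oppr_lt0 divr_gt0.
apply: ereal_inf_lbound; exists (x - r / 2) => //; apply: rX.
rewrite /ball /= opprD addrA subrr add0r opprK gtr0_norm ?divr_gt0 //.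
by rewrite ltr_pdivrMr // ltr_pMr // ltr1n.
Qed.

Lemma le_U A e x : A e x -> (x%:E <= U_ A e)%E.
Proof. by move=> Ax; apply: ereal_sup_ubound; exists x. Qed.

Lemma L_le A e x : A e x -> (L_ A e <= x%:E)%E.
Proof. by move=> Ax; apply: ereal_inf_lbound; exists x. Qed.

(** The form in which the restriction on areas enters: a nontrivial area attains neither of its
    limits. *)
Lemma open_or_trivialP A e x : open_or_trivial A -> e \in edges G -> A e x ->
  (L_ A e < x%:E /\ x%:E < U_ A e)%E \/ (L_ A e = x%:E /\ U_ A e = x%:E).
Proof.
move=> oA /oA[oX|[v Av]] Ax; [left|right].
  by split; [apply: open_gt_inf|apply: open_lt_sup].
move: Ax; rewrite /L_ /U_ Av => ->.
by rewrite image_set1 ereal_sup1 ereal_inf1.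
Qed.

Lemma edge_leE A e f :
  edge_le A e f =
  (L_ A e < L_ A f)%E || (L_ A e == L_ A f) && (U_ A e <= U_ A f)%E.
Proof.
by rewrite /edge_le /edge_lt -orbA -andb_orr [(U_ A e <= _)%E]le_eqVlt orbC
  [(U_ A e < _)%E || _]orbC orbC.
Qed.

Lemma edge_le_trans A : transitive (edge_le A).
Proof.
move=> f e c; rewrite !edge_leE => /orP[ef|/andP[/eqP ef Uef]].
  by case/orP => [fc|/andP[/eqP <- _]]; rewrite ?ef // (lt_trans ef).
by rewrite ef => /orP[->//|/andP[/eqP-> Ufc]]; rewrite eqxx (le_trans Uef) // orbT.
Qed.

Lemma edge_le_total A : total (edge_le A).
Proof.
by move=> e f; rewrite !edge_leE; case: ltgtP => //= _; apply: le_total.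
Qed.

Lemma edge_leL A e f : edge_le A e f -> (L_ A e <= L_ A f)%E.
Proof. by rewrite edge_leE => /orP[/ltW//|/andP[/eqP->]]. Qed.

(** The tie-break on upper limits matters here: it puts a trivial area before an open one with the
    same lower limit, so an edge following a nontrivial [e] cannot have weight [L_ A e]. *)
Lemma lt_edge_weight A e f x : open_or_trivial A -> f \in edges G -> A f x ->
  edge_le A e f -> (L_ A e < U_ A e)%E -> (L_ A e < x%:E)%E.
Proof.
move=> oA fE Ax ef LU.
have [[Lx _]|[Lx Ux]] := open_or_trivialP oA fE Ax.
  exact: le_lt_trans (edge_leL ef) Lx.
move: ef; rewrite edge_leE Lx => /orP[//|/andP[/eqP Le]].
by rewrite Ux Le leNgt -Le LU.
Qed.

Lemma realizes_update A w e : realizes A w -> realizes (update_area A e (w e)) w.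
Proof. by move=> Aw c cE; rewrite /update_area; case: eqP => [->//|_]; exact: Aw. Qed.

Lemma open_or_trivial_update A e x :
  open_or_trivial A -> open_or_trivial (update_area A e x).
Proof.
move=> oA c cE; rewrite /update_area; case: eqP => [_|_]; last exact: oA.
by right; exists x.
Qed.

Lemma guaranteed_mst_sub A B T :
  (forall e x, e \in edges G -> B e x -> A e x) ->
  guaranteed_mst A T -> guaranteed_mst B T.
Proof. by move=> BA AT w Bw; apply: AT => e eE; apply: BA => //; apply: Bw. Qed.

(* [r] is the list of the edges processed so far.  The last clause holds for all
   weights in the areas at once: deleting an always maximal edge preserves it. *)
Definition loop_inv B (s : seq {set G}) F : Prop := exists r,
  [/\ perm_eq (r ++ s) (enum (edges G)), sorted (edge_le B) (r ++ s),
      {subset F <= r}, forest F &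
      forall w x y, realizes B w -> [set x; y]%SET \in r ->
        connect (adj [set d in F | w d <= w [set x; y]%SET]%SET) x y].

Lemma loop_inv_start B s :
  perm_eq s (enum (edges G)) -> sorted (edge_le B) s ->
  loop_inv B s finset.set0.
Proof.
move=> ps ss; exists [::]; split=> //.
- by move=> e; rewrite inE.
- by move=> x y; rewrite inE.
Qed.

Lemma loop_inv_edges B e s F : loop_inv B (e :: s) F ->
  [/\ e \in edges G, F \subset edges G & (e |: F)%SET \subset edges G].
Proof.
case=> r [pr _ Fr _ _].
have rE c : c \in r ++ e :: s -> c \in edges G by rewrite (perm_mem pr) mem_enum.
have eE : e \in edges G by apply: rE; rewrite mem_cat inE eqxx orbT.
have FE : F \subset edges G.
  by apply/fintype.subsetP => c /Fr cr; apply: rE; rewrite mem_cat cr.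
by split=> //; rewrite finset.subUset finset.sub1set eE.
Qed.

Lemma loop_inv_add B e s F :
  (forall C, ~ is_cycle (e |: F)%SET C) ->
  loop_inv B (e :: s) F -> loop_inv B s (e |: F)%SET.
Proof.
move=> acF inv; have [eE FE eFE] := loop_inv_edges inv.
case: inv => r [pr sr Fr fF cF]; exists (rcons r e); rewrite cat_rcons; split=> //.
- move=> c; rewrite in_setU1 mem_rcons inE => /orP[->//|/Fr->].
  by rewrite orbT.
- apply: forest_acyclic => // x y /(fintype.subsetP eFE); exact: edge_neq.
move=> w x y Bw; rewrite mem_rcons inE => /orP[/eqP xye|xyr].
  by apply: connect1; rewrite /adj !inE xye eqxx lexx.
apply: connect_adj_subset (cF w x y Bw xyr); apply/fintype.subsetP => d.
by rewrite !inE => /andP[-> ->]; rewrite orbT.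
Qed.

Lemma loop_inv_delete B e s F C d :
  is_cycle (e |: F)%SET C -> always_maximal B C d ->
  loop_inv B (e :: s) F -> loop_inv B s ((e |: F) :\ d)%SET.
Proof.
move=> cC [dC maxd] inv; have [eE FE eFE] := loop_inv_edges inv.
case: inv => r [pr sr Fr fF cF]; exists (rcons r e); rewrite cat_rcons; split=> //.
- move=> c; rewrite in_setD1 in_setU1 mem_rcons inE => /andP[_].
  by move=> /orP[->//|/Fr->]; rewrite orbT.
- have [x [y ee]] := edgeP eE; subst e; apply: forest_break cC dC _ => //.
  by move=> c /(fintype.subsetP FE)/edgeP.
move=> w x y Bw xyr.
have : connect (adj [set c in (e |: F)%SET | w c <= w [set x; y]%SET]%SET) x y.
  move: xyr; rewrite mem_rcons inE => /orP[/eqP xye|xyr].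
    by apply: connect1; rewrite /adj !inE xye eqxx lexx.
  apply: connect_adj_subset (cF w x y Bw xyr); apply/fintype.subsetP => c.
  by rewrite !inE => /andP[-> ->]; rewrite orbT.
apply: connect_adj_sub => a b; rewrite inE => /andP[abF lew].
have [abd|abd] := eqVneq [set a; b]%SET d; last first.
  by apply: connect1; rewrite /adj inE in_setD1 abd abF.
(* A path through [d] is rerouted along the rest of [C], where each edge [c] satisfies
   [w c <= U_ B c <= L_ B d <= w d]. *)
rewrite -abd in dC maxd *; apply: connect_adj_subset (is_cycle_connect cC dC).
apply/fintype.subsetP => c ccd; move: (ccd); rewrite in_setD1 => /andP[cd cC'].
have cF' := fintype.subsetP (is_cycle_subset cC) _ cC'.
rewrite inE in_setD1 cd cF' /=; apply: le_trans lew; rewrite -lee_fin.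
have cE := fintype.subsetP eFE _ cF'.
apply: le_trans (le_U (Bw _ cE)) (le_trans (maxd _ ccd) (L_le (Bw _ _))).
exact: fintype.subsetP eFE _ abF.
Qed.

(** With all edges processed, the invariant is the bottleneck criterion, for every choice of weights
    in the areas. *)
Lemma loop_inv_mst B F : loop_inv B [::] F -> guaranteed_mst B F.
Proof.
case=> r [pr _ Fr fF cF] w Bw; rewrite cats0 in pr.
have rE e : (e \in r) = (e \in edges G) by rewrite (perm_mem pr) mem_enum.
have bF x y : [set x; y]%SET \in edges G ->
     connect (adj [set d in F | w d <= w [set x; y]%SET]%SET) x y.
  by rewrite -rE; apply: cF.
apply: (bottleneck_mst _ bF); apply/spanning_treeP; split=> //.
  by apply/fintype.subsetP => e /Fr; rewrite rE.
move=> x y; apply: connect_adj_sub (@connected_graph G x y) => a b /bF.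
apply: connect_adj_subset; apply/fintype.subsetP => d.
by rewrite inE => /andP[].
Qed.

Lemma ured_witness B e s F C f g w S :
  open_or_trivial B -> realizes B w -> loop_inv B (e :: s) F ->
  is_cycle (e |: F)%SET C -> (forall d, ~ always_maximal B C d) ->
  f \in C -> U_ B f = \big[maxe/-oo%E]_(c in C) U_ B c ->
  g \in (C :\ f)%SET -> (L_ B f < U_ B g)%E ->
  update_solution B w S -> (f \in S) || (g \in S).
Proof.
move=> oB Bw inv cC noam fC Uf gCf LfUg [SE [T BT]]; apply: contraT.
rewrite negb_or => /andP[fS gS].
have [eE FE eFE] := loop_inv_edges inv.
have [gf gC] : g != f /\ g \in C by move: gCf; rewrite in_setD1 => /andP[].
have CeF := fintype.subsetP (is_cycle_subset cC).
have eFE' := fintype.subsetP eFE.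
have CE c : c \in C -> c \in edges G by move=> cC'; exact/eFE'/CeF.
have leUf c : c \in C -> (U_ B c <= U_ B f)%E.
  by move=> cC'; rewrite Uf; exact: (le_bigmax_cond _ _ cC').
have LUf : (L_ B f < U_ B f)%E := lt_le_trans LfUg (leUf _ gC).
(* Strictness for a trivial area: a known weight equal to [U_ B f], the largest upper limit on [C],
   would make [c] always maximal. *)
have ltUf c : c \in (C :\ f)%SET -> ((w c)%:E < U_ B f)%E.
  rewrite in_setD1 => /andP[cf cC'].
  have [[_ /lt_le_trans]|[Lc Uc]] := open_or_trivialP oB (CE _ cC') (Bw _ (CE _ cC')).
    by apply; apply: leUf.
  rewrite -Uc lt_neqAle leUf // andbT; apply/eqP => UcUf.
  apply: (noam c); split=> // c'; rewrite in_setD1 => /andP[_ c'C].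
  by rewrite Lc -Uc UcUf leUf.
have fT : f \notin T.
  (* Finitely many weights below [U_ B f] leave room for a value [v] of [f] above all of them; the
     default [-oo] is below [U_ B f] too. *)
  have /ereal_sup_gt[_ [v Bv <-] vmax] :
      (\big[maxe/-oo]_(c in (C :\ f)%SET) (w c)%:E < U_ B f)%E.
    apply/bigmax_ltP; split=> //.
    by apply: le_lt_trans (ltUf g gCf); rewrite leNye.
  pose w2 c := if c == f then v else w c.
  have w2T : is_mst w2 T.
    apply: BT => c cE; rewrite /update_all /w2.
    case: eqP => [->|_]; first by rewrite (negPf fS).
    by case: ifP => // _; apply: Bw.
  apply: (mst_cycle_max w2T cC eFE fC).
  move=> c cCf; rewrite /w2 eqxx.
  have := cCf; rewrite in_setD1 => /andP[/negPf-> _].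
  by rewrite -lte_fin; apply: le_lt_trans vmax; exact: (le_bigmax_cond _ _ cCf).
have /ereal_sup_gt[_ [vg Bvg <-] Lvg] := LfUg.
pose P c := (c \in edges G) && (L_ B f < (w c)%:E)%E.
(* This [v] lies below [vg] and below every weight exceeding [L_ B f]. Under [w1], an edge other
   than [f] of weight at most [v] thus weighs at most [L_ B f]. *)
have /ereal_inf_lt[_ [v Bv <-] vmin] :
    (L_ B f < \big[mine/vg%:E]_(c | P c) (w c)%:E)%E.
  by apply/bigmin_gtP; split=> // c /andP[].
pose w1 c := if c == f then v else if c == g then vg else w c.
have w1B : realizes B w1.
  move=> c cE; rewrite /w1; case: eqP => [->//|_].
  by case: eqP => [->//|_]; exact: Bw.
have w1T : is_mst w1 T.
  apply: BT => c cE; rewrite /update_all /w1.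
  case: eqP => [->|_]; first by rewrite (negPf fS).
  case: eqP => [->|_]; first by rewrite (negPf gS).
  by case: ifP => // _; apply: Bw.
have w1f : w1 f = v by rewrite /w1 eqxx.
have w1g : w1 g = vg by rewrite /w1 (negPf gf) eqxx.
have vvg : v < vg by rewrite -lte_fin (lt_le_trans vmin) // bigmin_le_id.
have Lv := L_le Bv.
have w1P c : c != f -> c \in edges G -> w1 c <= v -> ((w1 c)%:E <= L_ B f)%E.
  rewrite /w1 => /negPf-> cE.
  case: eqP => [_|_ wcv]; first by rewrite leNgt vvg.
  rewrite leNgt; apply/negP => Lwc.
  have : (v%:E < (w c)%:E)%E.
    apply: lt_le_trans vmin _; apply: (@bigmin_le_cond _ _ _ _ _ P).
    by rewrite /P cE.
  by rewrite lte_fin ltNge wcv.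
have [x [y ef]] := edgeP (CE _ fC).
have Lw1f : (L_ B f < (w1 f)%:E)%E.
  have [[]|[Lf' Uf']] // := open_or_trivialP oB (CE _ fC) (w1B _ (CE _ fC)).
  by move: LUf; rewrite Lf' Uf' ltxx.
have Lw1g : (L_ B f < (w1 g)%:E)%E by rewrite w1g.
case: inv => r [pr sr Fr fF cF].
have TE : T \subset edges G by case: w1T => -[].
have fFg : forest ((e |: F) :\ g)%SET.
  have [x' [y' ee]] := edgeP eE; subst e; apply: forest_break cC gC _ => //.
  by move=> c /(fintype.subsetP FE)/edgeP.
have fFeg : [set x; y]%SET \in ((e |: F) :\ g)%SET.
  by rewrite -ef in_setD1 eq_sym gf CeF.
have /negP[] := fFg _ _ fFeg.
rewrite ef in fT; apply: connect_adj_sub (mst_connect_le w1T _ fT); last first.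
  by rewrite -ef CE.
rewrite -ef in fT * => a b; rewrite inE => /andP[abT lew].
have abE := fintype.subsetP TE _ abT.
have abf : [set a; b]%SET != f by apply: contraNneq fT => <-.
rewrite w1f in lew; have abL := w1P _ abf abE lew.
(* An edge not yet processed comes after [f] in the order, so [lt_edge_weight] would put its weight
   strictly above [L_ B f]. *)
have abr : [set a; b]%SET \in r.
  apply: contraT => abr; move: abL; rewrite leNgt => /negP[].
  apply: (lt_edge_weight oB abE (w1B _ abE) _ LUf).
  have : [set a; b]%SET \in r ++ e :: s by rewrite (perm_mem pr) mem_enum.
  rewrite mem_cat (negPf abr) /= => abes.
  move: sr; rewrite (sorted_pairwise (@edge_le_trans B)) pairwise_cat.
  case/and3P=> /allrelP lers _ /andP[/allP les _].
  have := CeF _ fC; rewrite in_setU1 => /orP[/eqP fe|/Fr fr].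
    rewrite fe; apply: les; move: abes; rewrite inE => /orP[|//].
    by rewrite -fe (negPf abf).
  exact: lers.
(* The invariant is applied to the weights [w1], under which both [f] and [g] exceed [L_ B f]; the
   path obtained therefore avoids both. *)
apply: connect_adj_subset (cF w1 a b w1B abr); apply/fintype.subsetP => c.
rewrite inE => /andP[cF' lec].
have {}lec : ((w1 c)%:E <= L_ B f)%E by apply: le_trans abL; rewrite lee_fin.
rewrite !inE cF' orbT andbT; apply/andP; split.
  by apply: contraTneq lec => ->; rewrite -ltNge.
by apply: contraTneq lec => ->; rewrite -ltNge.
Qed.

End Areas.

(** * How the optimum behaves under updates *)

Section Optimum.
Variables (R : realType) (G : graph) (w : weights R G).
Implicit Types (A B : areas R G) (f g : {set G}) (S : {set {set G}}).

Lemma update_solution_edges A : update_solution A w (edges G).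
Proof.
split=> //; have [T wT] := mst_exists w; exists T => w' w'A.
by apply: eq_is_mst wT => e eE; have := w'A e eE; rewrite /update_all eE.
Qed.

Lemma OPT_solution A :
  exists2 S, update_solution A w S & OPT A w = #|S|.
Proof.
rewrite /OPT; case: fintype.arg_minnP => [|S /asboolP sS _].
  by apply/asboolP/update_solution_edges.
by exists S.
Qed.

Lemma OPT_le A S : update_solution A w S -> (OPT A w <= #|S|)%N.
Proof.
move=> sS; rewrite /OPT; case: fintype.arg_minnP => [|S' _ minS].
  by apply/asboolP/update_solution_edges.
by apply/minS/asboolP.
Qed.

(** The resulting areas are contained in those after updating [S], whether or not [f] and [g] belong
    to [S], so the same tree stays guaranteed. *)
Lemma update_solutionD A f g S : realizes A w -> update_solution A w S ->
  update_solution (update_area (update_area A f (w f)) g (w g)) w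
    (S :\: [set f; g])%SET.
Proof.
move=> Aw [SE [T AT]]; split.
  exact: fintype.subset_trans (finset.subsetDl _ _) SE.
exists T; apply: guaranteed_mst_sub AT => e x eE.
rewrite /update_all /update_area !inE.
move: eE; have [-> gE|_ eE] := eqVneq e g.
  by rewrite /= if_same => xw; rewrite (xw : x = w g); case: ifP => // _; apply: Aw.
move: eE; have [-> fE|//] := eqVneq e f.
by move=> /= xw; rewrite (xw : x = w f); case: ifP => // _; apply: Aw.
Qed.

Lemma OPT_update_lt A f g : realizes A w ->
  (forall S, update_solution A w S -> (f \in S) || (g \in S)) ->
  (OPT (update_area (update_area A f (w f)) g (w g)) w < OPT A w)%N.
Proof.
move=> Aw hit; have [S sS ->] := OPT_solution A.
apply: leq_ltn_trans (OPT_le (update_solutionD f g Aw sS)) _.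
apply: proper_card; rewrite properE finset.subsetDl /=.
apply/subsetPn; case/orP: (hit _ sS) => h; [exists f|exists g] => //.
  by rewrite !inE eqxx.
by rewrite !inE eqxx orbT.
Qed.

End Optimum.

(** * Invariant, termination and update count of u-red *)

Section URed.
Variables (R : realType) (G : graph) (w : weights R G).
Implicit Types (A B : areas R G) (st : ured_state R G).

Definition valid_areas B := realizes B w /\ open_or_trivial B.

Definition ured_good st : Prop :=
  match st with
  | URedStart B => valid_areas B
  | URedLoop B s F => valid_areas B /\ loop_inv B s F
  | URedSecond B g => valid_areas B /\ g \in edges G
  end.

Definition ured_areas st : areas R G :=
  match st with URedStart B | URedLoop B _ _ | URedSecond B _ => B end.

(* Twice the optimum of the remaining instance, plus one between the two updates
   of a pair: updates made plus cost never exceed twice the initial optimum. *)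
Definition ured_cost st : nat :=
  match st with
  | URedStart B | URedLoop B _ _ => (OPT B w).*2
  | URedSecond B g => (OPT (update_area B g (w g)) w).*2.+1
  end.

(** A lexicographic measure, first the optimum and then the position within a round, packed into one
    number: the factor [#|edges G|.+3] exceeds every second summand that occurs. *)
Definition ured_measure st : nat :=
  match st with
  | URedStart B => OPT B w * #|edges G|.+3 + #|edges G|.+1
  | URedLoop B s _ => OPT B w * #|edges G|.+3 + size s
  | URedSecond B g =>
      OPT (update_area B g (w g)) w * #|edges G|.+3 + #|edges G|.+2
  end.

Lemma valid_update B e : valid_areas B -> valid_areas (update_area B e (w e)).
Proof.
by case=> Bw oB; split; [apply: realizes_update|apply: open_or_trivial_update].
Qed.

(** A single case analysis over the moves, from which termination, correctness and the update bound
    are all read off. *)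
Lemma ured_step st a : ured_move st a -> ured_good st ->
  match a with
  | Compute st' =>
      [/\ ured_good st', ured_areas st' = ured_areas st,
          ured_cost st' = ured_cost st &
          (ured_measure st' < ured_measure st)%N]
  | Update e k =>
      e \in edges G /\
      [/\ ured_good (k (w e)),
          ured_areas (k (w e)) = update_area (ured_areas st) e (w e),
          (ured_cost (k (w e)) < ured_cost st)%N &
          (ured_measure (k (w e)) < ured_measure st)%N]
  | Output T => guaranteed_mst (ured_areas st) T
  end.
Proof.
case=> {st a}.
- move=> B s ps ss vB /=; split=> //; first by split=> //; apply: loop_inv_start.
  by rewrite (perm_size ps) -cardE ltn_add2l.
- move=> B e s F acF [vB inv] /=; split=> //; last by rewrite ltn_add2l.
  by split=> //; apply: loop_inv_add inv.
- move=> B e s F C d cC maxd [vB inv] /=; split=> //; last by rewrite ltn_add2l.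
  by split=> //; apply: loop_inv_delete cC maxd inv.
- move=> B e s F C f g cC noam fC Uf gCf LU [vB inv] /=.
  have [_ _ eFE] := loop_inv_edges inv.
  have CE c : c \in C -> c \in edges G.
    by move/(fintype.subsetP (is_cycle_subset cC))/(fintype.subsetP eFE).
  have lt : (OPT (update_area (update_area B f (w f)) g (w g)) w < OPT B w)%N.
    apply: OPT_update_lt => [|S]; first by case: vB.
    by case: vB => Bw oB; exact: ured_witness oB Bw inv cC noam fC Uf gCf LU.
  split; first exact: CE.
  split=> //.
  + by split; [apply: valid_update|apply: CE; move: gCf; rewrite !inE => /andP[]].
  (* The optimum after both updates has dropped by at least one, hence twice its value by at least
     two, of which one is kept for the second update. *)
  + by rewrite -doubleS leq_double.
  + apply: (@leq_trans (OPT B w * #|edges G|.+3)); last exact: leq_addr.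
    by rewrite -addnS -mulSnr leq_mul2r lt orbT.
- move=> B g [vB gE] /=; split=> //; split=> //; first exact: valid_update.
  by rewrite ltn_add2l.
- by move=> B F [vB inv]; apply: loop_inv_mst inv.
Qed.

Lemma ured_progress st : ured_good st -> exists a, ured_move st a.
Proof.
case: st => [B vB|B [|e s] F [vB inv]|B g _].
- exists (Compute (URedLoop B (sort (edge_le B) (enum (edges G))) finset.set0)).
  apply: ured_sort; first by rewrite perm_sort.
  exact/sort_sorted/edge_le_total.
- by exists (Output F); apply: ured_return.
- have [[C cC]|nC] := pselect (exists C, is_cycle (e |: F)%SET C); last first.
    eexists; apply: ured_add => C cC; apply: nC; by exists C.
  have [[d maxd]|nd] := pselect (exists d, always_maximal B C d).
    by eexists; apply: ured_delete cC maxd.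
  have [c0 c0C] : exists c0, c0 \in C.
    case: cC => -[|x p] [] // _ _ ->; exists [set x; next (x :: p) x]%SET.
    by apply: imset_f; rewrite inE eqxx.
  have [f fC Uf] : {f | f \in C & \big[maxe/-oo%E]_(c in C) U_ B c = U_ B f}.
    by apply: Order.TotalTheory.eq_bigmax c0C _ => c _; exact: leNye.
  have noam d : ~ always_maximal B C d by move=> md; apply: nd; exists d.
  (* Without such a [g], the edge [f] itself would be always maximal. *)
  have [g [gCf LU]] : exists g, g \in (C :\ f)%SET /\ (L_ B f < U_ B g)%E.
    apply: contrapT => ng; apply: (noam f); split=> // c cCf.
    by rewrite leNgt; apply/negP => LU; apply: ng; exists c.
  by eexists; apply: ured_update cC noam fC (esym Uf) gCf LU.
- by eexists; apply: ured_update2.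
Qed.

Lemma ured_acc st : ured_good st -> Acc (next_state (alg := u_red R) w) st.
Proof.
have [n] := ubnP (ured_measure st); elim: n st => [|n IHn] st; first by rewrite ltn0.
move=> ltn gst; constructor=> st' [mv|[e [k [mv ->]]]].
  have [g' _ _ lt] := ured_step mv gst.
  by apply: IHn g'; apply: leq_trans lt _.
have [_ [g' _ _ lt]] := ured_step mv gst.
by apply: IHn g'; apply: leq_trans lt _.
Qed.

(** Each update adds one to the length of [h] and lowers the cost by at least one. Passing to the
    set of [h] is harmless, as a repeated update reveals the same weight. *)
Lemma ured_reaches A st h : valid_areas A -> reaches (alg := u_red R) A w st h ->
  [/\ ured_good st, ured_areas st = update_all A w [set e in h]%SET &
      (size h + ured_cost st <= (OPT A w).*2)%N].
Proof.
move=> vA; elim=> {st h} /= [|st st' h _ [gst aA leA] mv|st e k h _ [gst aA leA] mv].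
- split=> //; rewrite /update_all; apply/funext => e; by rewrite !inE.
- by have [g' -> -> _] := ured_step mv gst.
have [eE [g' -> lt _]] := ured_step mv gst.
split=> //; last by rewrite addSnnS; apply: leq_trans leA; rewrite leq_add2l.
rewrite aA; apply/funext => c; rewrite /update_area /update_all !inE.
by case: eqP => [->|].
Qed.

End URed.

Theorem theorem3p7 (R : realType) :
  update_competitive (u_red R) (@open_or_trivial R) 2%:R.
Proof.
(* The additive constant is 0, since the initial cost is exactly twice the optimum. *)
exists 0 => G A w Aw oA; have vA : valid_areas w A by [].
split; first split.
- exact: ured_acc.
- by move=> st h /(ured_reaches vA)[gst _ _]; apply: ured_progress gst.
- by move=> st h e k /(ured_reaches vA)[gst _ _] mv; case: (ured_step mv gst).
- move=> st h T /(ured_reaches vA)[gst <- _] mv; exact: ured_step mv gst.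
move=> st h /(ured_reaches vA)[_ _ le].
rewrite addr0 -natrM ler_nat mul2n; apply: leq_trans le; exact: leq_addr.
Qed.
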